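(* Let $M$ be the limit of a weak Fraïssé class in a finite relational signature. Then $M$ is homogenizable if and only if $M$ is $\omega$-categorical and $\mathrm{age}(M)$ has SEAP.
   Context: A weak Fraïssé class is a class $\mathcal{K}$ of finitely generated structures in a fixed signature, containing countably many isomorphism types, with the hereditary property (closed under substructures), the joint embedding property (any two members embed into a common member) and the weak amalgamation property: for every $A\in\mathcal{K}$ there are $A'\in\mathcal{K}$ and an embedding $\tau:A\to A'$ such that for all $B_1,B_2\in\mathcal{K}$ and embeddings $\phi_i:A'\to B_i$ there are $C\in\mathcal{K}$ and embeddings $\psi_i:B_i\to C$ with $\psi_1\circ\phi_1\circ\tau=\psi_2\circ\phi_2\circ\tau$. The limit of a weak Fraïssé class $\mathcal{K}$ (in a finite relational signature) is the unique up to isomorphism countable structure $M$ with $\mathrm{age}(M)=\mathcal{K}$ (the class of finite structures embeddable in $M$) such that for every finite substructure $A\subseteq M$ there is a finite substructure $B$ with $A\subseteq B\subseteq M$ such that for every $C\in\mathcal{K}$ and embedding $e:B\to C$ there is an embedding $f:C\to M$ with $f\circ e\restriction A=\mathrm{Id}_A$. A structure $M$ in signature $L$ is homogenizable if there are $L$-formulas $\phi_0(\bar x_0),\dots,\phi_n(\bar x_n)$ such that the expansion $M'$ of $M$ to $L'=L\cup\{R_0,\dots,R_n\}$ (each $R_i$ a new relation symbol of the arity of $\phi_i$) given by $R_i(\bar a)\iff M\models\phi_i(\bar a)$ is ultrahomogeneous (every isomorphism between finitely generated substructures of $M'$ extends to an automorphism of $M'$). For $k,m\in\mathbb{N}$,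 a class $\mathcal{K}$ of finite structures satisfies $\mathrm{SEAP}_{k,m}$ if: for any $A,B,C\in\mathcal{K}$ and embeddings $\phi:A\to B$, $\psi:A\to C$ that cannot be amalgamated over $A$ (i.e. there are no $D\in\mathcal{K}$ and embeddings $\beta:B\to D$, $\gamma:C\to D$ with $\beta\circ\phi=\gamma\circ\psi$), there exist $A_0,B_0,C_0\in\mathcal{K}$ with $A_0\subseteq A$, $B_0\supseteq B$, $C_0\supseteq C$, $|A_0|<k$, $|B_0|-|B|<m$, $|C_0|-|C|<m$, such that the embeddings $\phi_0=\phi\restriction A_0:A_0\to B_0$ and $\psi_0=\psi\restriction A_0:A_0\to C_0$ cannot be amalgamated over $A_0$. $\mathcal{K}$ satisfies SEAP if it satisfies $\mathrm{SEAP}_{k,m}$ for some $k,m\in\mathbb{N}$. *)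

(* Defs.v *)
From mathcomp Require Import all_boot finmap.

Set Implicit Arguments.
Unset Strict Implicit.
Unset Printing Implicit Defensive.

Local Open Scope fset_scope.

Record signature := Signature { symbol :> finType; arity : symbol -> nat }.

Definition structure (L : signature) (T : Type) :=
  forall r : L, (arity r).-tuple T -> Prop.

(* Structures with finitely many elements have a finType as domain, countable
   ones (finite ones included) a countType.  The empty domain is allowed. *)

Definition preserves (L : signature) (T U : Type)
    (A : structure L T) (B : structure L U) (f : T -> U) : Prop :=
  forall (r : L) (t : (arity r).-tuple T), A r t <-> B r (map_tuple f t).

Definition embedding (L : signature) (T U : Type)
    (A : structure L T) (B : structure L U) (f : T -> U) : Prop :=
  injective f /\ preserves A B f.

Definition isomorphism (L : signature) (T U : Type)
    (A : structure L T) (B : structure L U) (f : T -> U) : Prop :=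
  bijective f /\ preserves A B f.

Definition isomorphic (L : signature) (T U : Type)
    (A : structure L T) (B : structure L U) : Prop :=
  exists f : T -> U, isomorphism A B f.

(* In a relational signature every subset carries a substructure, and the
   finitely generated substructures are those on finite subsets. *)
Definition substructure (L : signature) (T : choiceType)
    (A : structure L T) (S : {fset T}) : structure L S :=
  fun r t => A r (map_tuple val t).
Arguments substructure {L T} A S.

Definition fin_class (L : signature) :=
  forall T : finType, structure L T -> Prop.

Definition age (L : signature) (T : Type) (M : structure L T) : fin_class L :=
  fun U A => exists f : U -> T, embedding A M f.

Section Classes.
Variables (L : signature) (K : fin_class L).

Definition iso_closed : Prop :=
  forall (T U : finType) (A : structure L T) (B : structure L U),
    isomorphic A B -> K A -> K B.

Definition countably_many_isotypes : Prop :=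
  exists (T : nat -> finType) (S : forall n, structure L (T n)),
    forall (U : finType) (A : structure L U),
      K A -> exists n, isomorphic A (S n).

Definition hereditary : Prop :=
  forall (T : finType) (A : structure L T) (S : {fset T}),
    K A -> K (substructure A S).

Definition joint_embedding : Prop :=
  forall (T1 T2 : finType) (A1 : structure L T1) (A2 : structure L T2),
    K A1 -> K A2 ->
    exists (U : finType) (B : structure L U) (f1 : T1 -> U) (f2 : T2 -> U),
      [/\ K B, embedding A1 B f1 & embedding A2 B f2].

(* Only the underlying maps of the embeddings phi and psi matter here; that
   they are embeddings of a common structure on X is stated where it is used. *)
Definition amalgamable (X T1 T2 : finType)
    (B1 : structure L T1) (B2 : structure L T2)
    (phi : X -> T1) (psi : X -> T2) : Prop :=
  exists (U : finType) (D : structure L U) (beta : T1 -> U) (gamma : T2 -> U),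
    [/\ K D, embedding B1 D beta, embedding B2 D gamma
      & beta \o phi =1 gamma \o psi].

Definition weak_amalgamation : Prop :=
  forall (T : finType) (A : structure L T), K A ->
  exists (T' : finType) (A' : structure L T') (tau : T -> T'),
    [/\ K A', embedding A A' tau
      & forall (T1 T2 : finType) (B1 : structure L T1) (B2 : structure L T2)
               (phi1 : T' -> T1) (phi2 : T' -> T2),
          K B1 -> K B2 -> embedding A' B1 phi1 -> embedding A' B2 phi2 ->
          amalgamable B1 B2 (phi1 \o tau) (phi2 \o tau)].

Definition weak_Fraisse_class : Prop :=
  [/\ iso_closed, countably_many_isotypes, hereditary, joint_embedding
    & weak_amalgamation].

(* The supersets B0 of B and C0 of C are given by embeddings iB and iC. *)
Definition SEAP_ (k m : nat) : Prop :=
  forall (T TB TC : finType)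
         (A : structure L T) (B : structure L TB) (C : structure L TC)
         (phi : T -> TB) (psi : T -> TC),
    K A -> K B -> K C -> embedding A B phi -> embedding A C psi ->
    ~ amalgamable B C phi psi ->
  exists (S : {fset T}) (TB0 TC0 : finType)
         (B0 : structure L TB0) (C0 : structure L TC0)
         (iB : TB -> TB0) (iC : TC -> TC0),
    [/\ K (substructure A S), K B0, K C0,
        embedding B B0 iB & embedding C C0 iC] /\
    [/\ #|` S| < k, #|TB0| - #|TB| < m, #|TC0| - #|TC| < m
      & ~ amalgamable B0 C0 (fun x : S => iB (phi (val x)))
                            (fun x : S => iC (psi (val x)))].

Definition SEAP : Prop := exists k m : nat, SEAP_ k m.

Definition is_limit (T : countType) (M : structure L T) : Prop :=
  (forall (U : finType) (A : structure L U), age M A <-> K A) /\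
  (forall SA : {fset T}, exists SB : {fset T},
     SA `<=` SB /\
     forall (U : finType) (C : structure L U) (e : SB -> U),
       K C -> embedding (substructure M SB) C e ->
       exists f : U -> T,
         embedding C M f /\
         forall x : SB, val x \in SA -> f (e x) = val x).

End Classes.

(* First-order formulas with equality; the index n is the number of variables
   in scope, and FAll binds variable 0. *)
Inductive formula (L : signature) : nat -> Type :=
| FBot n : formula L n
| FEq n : 'I_n -> 'I_n -> formula L n
| FRel n (r : L) : (arity r).-tuple 'I_n -> formula L n
| FImp n : formula L n -> formula L n -> formula L n
| FAll n : formula L n.+1 -> formula L n.

Fixpoint sat (L : signature) (T : Type) (M : structure L T) (n : nat)
    (phi : formula L n) : n.-tuple T -> Prop :=
  match phi in formula _ n return n.-tuple T -> Prop with
  | FBot _ => fun _ => False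
  | FEq _ i j => fun a => tnth a i = tnth a j
  | FRel _ r t => fun a => M r (map_tuple (tnth a) t)
  | FImp _ p q => fun a => sat M p a -> sat M q a
  | FAll _ p => fun a => forall x : T, sat M p (cons_tuple x a)
  end.

Definition elementarily_equivalent (L : signature) (T U : Type)
    (M : structure L T) (N : structure L U) : Prop :=
  forall phi : formula L 0, sat M phi [tuple] <-> sat N phi [tuple].

(* N is a model of Th(M) iff it is elementarily equivalent to M.  A finite M
   is omega-categorical in this sense. *)
Definition omega_categorical (L : signature) (T : countType)
    (M : structure L T) : Prop :=
  forall (U : countType) (N : structure L U),
    elementarily_equivalent M N -> isomorphic M N.

Definition ultrahomogeneous (L : signature) (T : choiceType)
    (M : structure L T) : Prop :=
  forall (A B : {fset T}) (f : A -> B),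
    isomorphism (substructure M A) (substructure M B) f ->
    exists g : T -> T,
      isomorphism M M g /\ forall x : A, g (val x) = val (f x).

Definition expanded_signature (L : signature) (n : nat) (ar : 'I_n -> nat) :=
  @Signature (L + 'I_n)%type
    (fun s => match s with inl r => arity r | inr i => ar i end).

Definition expansion (L : signature) (T : Type) (M : structure L T) (n : nat)
    (ar : 'I_n -> nat) (phi : forall i : 'I_n, formula L (ar i)) :
    structure (expanded_signature L ar) T :=
  fun s => match s return (@arity (expanded_signature L ar) s).-tuple T -> Prop
           with
           | inl r => M r
           | inr i => sat M (phi i)
           end.

Definition homogenizable (L : signature) (T : choiceType)
    (M : structure L T) : Prop :=
  exists (n : nat) (ar : 'I_n.+1 -> nat)
         (phi : forall i : 'I_n.+1, formula L (ar i)),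
    ultrahomogeneous (expansion M phi).

(* Main.v *)
Require Import Defs.
From mathcomp Require Import all_boot finmap.
From mathcomp Require Import boolp classical_sets filter.

(* In the limit M every finite tuple a lies in a finite set B such that any
   embedding of B into M moves a by an automorphism of M (back-and-forth);
   hence the orbit of a is defined by the existential formula that describes B.

   If the expansion of M by finitely many formulas is ultrahomogeneous, then the
   orbit of a tuple is determined by its quantifier-free type in the expansion,
   and there are finitely many such types for each length; back-and-forth gives
   omega-categoricity.  If B and C cannot be amalgamated over A, two embeddings
   into M disagree on one of the formulas at a short tuple of A; adding to B and
   C the sets that fix the orbits of the images of this tuple, which have bounded
   size, gives the obstruction required by SEAP.

   Conversely, if M has infinitely many orbits of n-tuples, a countable
   submodel of an ultrapower of M, made of Skolem terms in a sequence of tuples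
   that leaves every orbit, is elementarily equivalent to M but realizes an
   n-tuple that satisfies none of the orbit formulas, so it is not isomorphic to M.
   So there are finitely many orbits of tuples shorter than k; name them all.  By
   SEAP, tuples whose short subtuples are conjugate have amalgamable
   neighbourhoods, and are therefore conjugate. *)

Set Implicit Arguments.
Unset Strict Implicit.
Unset Printing Implicit Defensive.

Local Open Scope fset_scope.

(** * Maps and back-and-forth *)

Section Maps.
Variable L : signature.
Implicit Types T U V : Type.

Lemma map_tuple_comp n T U V (f : T -> U) (g : U -> V) (t : n.-tuple T) :
  map_tuple g (map_tuple f t) = map_tuple (g \o f) t.
Proof. by apply: val_inj; rewrite /= -map_comp. Qed.

Lemma eq_map_tuple n T U (f g : T -> U) (t : n.-tuple T) :
  f =1 g -> map_tuple f t = map_tuple g t.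
Proof. by move=> fg; apply: val_inj; apply: eq_map. Qed.

Lemma map_tuple_id n T (t : n.-tuple T) : map_tuple id t = t.
Proof. exact/val_inj/map_id. Qed.

Lemma map_tuple_cancel n T U (f : T -> U) (g : U -> T) (t : n.-tuple T) :
  cancel f g -> map_tuple g (map_tuple f t) = t.
Proof. by move=> fK; apply: val_inj; rewrite /= mapK. Qed.

Lemma map_tnth_map n m T U (f : T -> U) (a : m.-tuple T) (t : n.-tuple 'I_m) :
  map_tuple (tnth (map_tuple f a)) t = map_tuple f (map_tuple (tnth a) t).
Proof. by apply: eq_from_tnth => i; rewrite !tnth_map. Qed.

Lemma embedding_comp T U V (A : structure L T) (B : structure L U)
    (C : structure L V) f g :
  embedding A B f -> embedding B C g -> embedding A C (g \o f).
Proof.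
move=> [fI fP] [gI gP]; split; first exact: inj_comp.
by move=> r t; rewrite -map_tuple_comp -gP -fP.
Qed.

Lemma isomorphism_embedding T U (A : structure L T) (B : structure L U) f :
  isomorphism A B f -> embedding A B f.
Proof. by move=> [/bij_inj]. Qed.

Lemma isomorphism_inv T U (A : structure L T) (B : structure L U) f :
  isomorphism A B f ->
  exists g, [/\ isomorphism B A g, cancel f g & cancel g f].
Proof.
move=> [[g fK gK] fP]; exists g; split=> //; split; first by exists f.
by move=> r t; rewrite fP map_tuple_cancel.
Qed.

Lemma isomorphism_comp T U V (A : structure L T) (B : structure L U)
    (C : structure L V) f g :
  isomorphism A B f -> isomorphism B C g -> isomorphism A C (g \o f).
Proof.
move=> [fb fP] [gb gP]; split; first exact: bij_comp.
by move=> r t; rewrite -map_tuple_comp -gP -fP.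
Qed.

Lemma sat_isomorphism T U (A : structure L T) (B : structure L U) f :
  isomorphism A B f ->
  forall n (phi : formula L n) a, sat A phi a <-> sat B phi (map_tuple f a).
Proof.
move=> [[g fK gK] fP] n phi; elim: phi => {n} /= [n|n i j|n r t|n p IHp q IHq|n p IHp] a.
- by [].
- by rewrite !tnth_map; split=> [->//|/(can_inj fK)].
- by rewrite fP map_tnth_map.
- by rewrite IHp IHq.
- have E x : map_tuple f (cons_tuple x a) = cons_tuple (f x) (map_tuple f a).
    exact: val_inj.
  by split=> H x; [rewrite -(gK x) -E -IHp | rewrite IHp E].
Qed.

End Maps.

Section Restriction.
Variables (L : signature) (T : choiceType) (U : Type).
Implicit Types (M : structure L T) (N : structure L U) (D E : {fset T}).

(** The map is total and only its values on D matter, so that composing with other maps and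
    shrinking D needs no passage between subtypes. *)
Definition embedding_on D M N (h : T -> U) : Prop :=
  {in D &, injective h} /\
  forall (r : L) (t : (arity r).-tuple T), {subset t <= D} ->
    (M r t <-> N r (map_tuple h t)).

Lemma lift_tuple n (t : n.-tuple T) D : {subset t <= D} ->
  exists t' : n.-tuple D, map_tuple val t' = t.
Proof.
move=> tD; exists [tuple [` tD _ (mem_tnth i t)] | i < n].
by apply: eq_from_tnth => i; rewrite tnth_map tnth_mktuple.
Qed.

Lemma embedding_onP D M N (h : T -> U) (f : D -> U) :
  (forall x : D, f x = h (val x)) ->
  embedding (substructure M D) N f <-> embedding_on D M N h.
Proof.
move=> fh; have E n (t : n.-tuple D) :
    map_tuple h (map_tuple val t) = map_tuple f t.
  by rewrite map_tuple_comp; apply: eq_map_tuple => x; rewrite /= fh.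
split=> [[fI fP]|[hI hP]]; split.
- move=> x y xD yD hxy.
  by have /fI/(congr1 val) : f [` xD] = f [` yD] by rewrite !fh.
- by move=> r t /lift_tuple[t' <-]; rewrite E -fP.
- by move=> x y; rewrite !fh => /hI e; apply/val_inj/e; apply: valP.
- move=> r t; rewrite /substructure -E; apply: hP => x /mapP[y _ ->].
  exact: valP.
Qed.

Lemma embedding_onS D E M N h :
  D `<=` E -> embedding_on E M N h -> embedding_on D M N h.
Proof.
move=> /fsubsetP DE [hI hP]; split=> [x y /DE xE /DE yE|r t tD]; first exact: hI.
by apply: hP => x /tD/DE.
Qed.

End Restriction.

Lemma extend_map (T : choiceType) (D : {fset T}) (f : D -> T) :
  exists h : T -> T, forall x : D, f x = h (val x).
Proof.
(* Outside D the extension is the identity, so no default element of T is required. *)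
exists (fun x => if insub x is Some z then f z else x) => x.
by rewrite valK.
Qed.

Section BackAndForth.
Variables (L : signature) (T U : countType).
Variables (M : structure L T) (N : structure L U).
Variable P : seq (T * U) -> Prop.

Hypothesis P_eq : forall s, P s ->
  forall p q, p \in s -> q \in s -> p.1 = q.1 <-> p.2 = q.2.
Hypothesis P_rel : forall s, P s ->
  forall (r : L) (t : (arity r).-tuple (T * U)), {subset t <= s} ->
  @M r (map_tuple fst t) <-> @N r (map_tuple snd t).
Hypothesis forth : forall s, P s -> forall x, exists s',
  [/\ P s', {subset s <= s'} & exists y, (x, y) \in s'].
Hypothesis back : forall s, P s -> forall y, exists s',
  [/\ P s', {subset s <= s'} & exists x, (x, y) \in s'].

Lemma back_and_forth_step (s : {s | P s}) (n : nat) : exists s' : {s | P s},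
  [/\ {subset sval s <= sval s'},
      forall x, choice.unpickle n = Some x -> exists y, (x, y) \in sval s'
    & forall y, choice.unpickle n = Some y -> exists x, (x, y) \in sval s'].
Proof.
case: s => s Ps.
have [s1 [Ps1 ss1 H1]] : exists s1, [/\ P s1, {subset s <= s1}
    & forall x, choice.unpickle n = Some x -> exists y, (x, y) \in s1].
  case: (choice.unpickle n) => [x|]; last by exists s; split.
  have [s1 [Ps1 ss1 xs1]] := forth Ps x.
  by exists s1; split=> // _ [<-].
have [s2 [Ps2 ss2 H2]] : exists s2, [/\ P s2, {subset s1 <= s2}
    & forall y, choice.unpickle n = Some y -> exists x, (x, y) \in s2].
  case: (choice.unpickle n) => [y|]; last by exists s1; split.
  have [s2 [Ps2 ss2 xs2]] := back Ps1 y.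
  by exists s2; split=> // _ [<-].
exists (exist _ s2 Ps2); split=> //=; first by move=> p /ss1/ss2.
by move=> x /H1[y /ss2]; exists y.
Qed.

Lemma back_and_forth s0 : P s0 ->
  exists g : T -> U, isomorphism M N g /\ forall p, p \in s0 -> g p.1 = p.2.
Proof.
move=> Ps0.
have [F HF] := choice (fun sn : {s | P s} * nat => back_and_forth_step sn.1 sn.2).
pose S := fix S n : {s | P s} := if n is m.+1 then F (S m, m) else exist _ s0 Ps0.
have Smono m n : m <= n -> {subset sval (S m) <= sval (S n)}.
  elim: n => [|n IH]; first by rewrite leqn0 => /eqP ->.
  rewrite leq_eqVlt => /predU1P[->//|/IH H] p /H.
  by have [+ _ _] := HF (S n, n); apply.
(* The graph of the isomorphism is the union of the increasing chain S; each element of T or U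
   enters it at the stage numbered by its code. *)
pose Q x y := exists n, (x, y) \in sval (S n).
have totl x : exists y, Q x y.
  have [_ + _] := HF (S (choice.pickle x), choice.pickle x).
  by move=> /(_ x (choice.pickleK x))[y ?]; exists y, (choice.pickle x).+1.
have totr y : exists x, Q x y.
  have [_ _ +] := HF (S (choice.pickle y), choice.pickle y).
  by move=> /(_ y (choice.pickleK y))[x ?]; exists x, (choice.pickle y).+1.
have [g Hg] := choice totl; have [h Hh] := choice totr.
have Qeq x y x' y' : Q x y -> Q x' y' -> x = x' <-> y = y'.
  move=> [m xy] [n xy'].
  have := P_eq (svalP (S (maxn m n))) (Smono _ _ (leq_maxl m n) _ xy).
  by move=> /(_ _ (Smono _ _ (leq_maxr m n) _ xy')).
have gK : cancel g h by move=> x; apply/(Qeq _ _ _ _ (Hh (g x)) (Hg x)).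
have hK : cancel h g by move=> y; apply/(Qeq _ _ _ _ (Hg (h y)) (Hh y)).
exists g; split; last first.
  by move=> [x y] s0p /=; apply/(Qeq _ _ _ _ (Hg x)); last by []; exists 0.
split; first by exists h.
move=> r t; pose u := map_tuple (fun x => (x, g x)) t.
(* [P_rel] speaks of a single stage, so a finite part of the graph must be found inside one member
   of the chain. *)
have bounded (l : seq (T * U)) : (forall p, p \in l -> Q p.1 p.2) ->
    exists n, {subset l <= sval (S n)}.
  elim: l => [|p l IH] lQ; first by exists 0.
  have [n ln] : exists n, {subset l <= sval (S n)}.
    by apply: IH => q ql; apply: lQ; rewrite inE ql orbT.
  have [m pm] := lQ p (mem_head _ _); exists (maxn m n) => q.
  rewrite inE => /predU1P[->|/ln]; last exact: Smono (leq_maxr _ _) _.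
  by move: pm; rewrite -surjective_pairing; apply: Smono (leq_maxl _ _) _.
have /bounded[n un] : forall p, p \in u -> Q p.1 p.2.
  by move=> p /mapP[x _ ->]; exact: Hg.
have := P_rel (svalP (S n)) un; rewrite !map_tuple_comp.
by rewrite (_ : map_tuple (fst \o _) t = t) // map_tuple_id.
Qed.

End BackAndForth.

(** * The limit of a weak Fraisse class *)

Section Limit.
Variables (L : signature) (T : countType) (M : structure L T).
Implicit Types A B D E : {fset T}.

(** The extension property in [is_limit], with K replaced by the age of M, which has the same
    members when M is the limit of K. *)
Definition limit_witness A B : Prop :=
  A `<=` B /\
  forall (U : finType) (C : structure L U) (e : B -> U),
    age M C -> embedding (substructure M B) C e ->
    exists f : U -> T, embedding C M f /\ forall x : B, val x \in A -> f (e x) = val x.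

Lemma substructure_age D : age M (substructure M D).
Proof.
exists val; apply/(embedding_onP _ _ (h := id)) => //; split=> // r t _.
by rewrite map_tuple_id.
Qed.

Lemma embedding_restrict D E (h : T -> T) :
  embedding_on D M M h -> (forall x, x \in D -> h x \in E) ->
  exists e : D -> E, embedding (substructure M D) (substructure M E) e /\
    forall x, val (e x) = h (val x).
Proof.
move=> [hI hP] hE; exists (fun x => [` hE _ (valP x)]); split=> //; split.
  by move=> x y /(congr1 val)/= /hI e; apply/val_inj/e; apply: valP.
move=> r t; rewrite /substructure hP; last by move=> x /mapP[y _ ->]; apply: valP.
by rewrite !map_tuple_comp.
Qed.

(** The extension property is applied to the substructure on E, with h seen as an embedding of B
    into it. *)
Lemma limit_witness_retract A B E (h : T -> T) :
  limit_witness A B -> embedding_on B M M h -> (forall x, x \in B -> h x \in E) ->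
  exists f, embedding_on E M M f /\ forall x, x \in A -> f (h x) = x.
Proof.
move=> [/fsubsetP AB gB] hB /(embedding_restrict hB)[e [eE eh]].
have [f [fE fe]] := gB _ _ e (substructure_age E) eE.
have [k fk] := extend_map f; exists k; split; first exact/embedding_onP/fE.
move=> x xA; have := fe [` AB _ xA] xA.
by rewrite fk eh.
Qed.

Hypothesis limM : forall A, exists B, limit_witness A B.

Let P (s : seq (T * T)) : Prop := exists A B (f : T -> T),
  [/\ limit_witness A B, embedding_on B M M f
    & forall p, p \in s -> p.1 \in A /\ f p.1 = p.2].

Let swap (p : T * T) := (p.2, p.1).

Let swapK : involutive swap. Proof. by case. Qed.

Let P_sub s s' : {subset s <= s'} -> P s' -> P s.
Proof. by move=> ss [A [B [f [gB fB fP]]]]; exists A, B, f; split=> // p /ss/fP. Qed.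

(* If f : B -> M is a partial isomorphism and E witnesses the limit property for
   f(B) and y, then a retraction E -> M of f extends the inverse of f to y. *)
Let P_swap s : P s -> forall y, exists x, P (map swap ((x, y) :: s)).
Proof.
move=> [A [B [f [gB fB fP]]]] y.
have [E gE] := limM (y |` f @` B).
have [|k [kE kf]] := limit_witness_retract gB fB (E := E).
  move=> x xB; case: gE => /fsubsetP + _; apply.
  by rewrite !inE in_imfset ?orbT.
have AB := gB.1.
exists (k y), (y |` f @` B), E, k; split=> // p.
rewrite inE => /predU1P[->|/mapP[q qs ->]] /=; first by rewrite fset1U1.
have [qA <-] := fP q qs; split; last exact: kf.
by rewrite !inE in_imfset ?orbT //; apply: (fsubsetP AB).
Qed.

(** [P_swap] reverses the map while adding a pair. Its first use serves only to reverse s and its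
    new pair is dropped; the second use restores the direction and adds x. For [P_back] the roles of
    the two uses are exchanged. *)
Let P_forth s : P s -> forall x, exists y, P ((x, y) :: s).
Proof.
move=> Ps x; have [x' Ps'] := P_swap Ps x.
have /P_swap : P (map swap s) by apply: P_sub Ps' => p ps; rewrite inE ps orbT.
move=> /(_ x)[y] /=; rewrite (mapK swapK) => Py.
by exists y.
Qed.

Let P_back s : P s -> forall y, exists x, P ((x, y) :: s).
Proof.
move=> Ps y; have [x /P_swap/(_ y)[z] /=] := P_swap Ps y.
rewrite (mapK swapK) => Py; exists x; apply: P_sub Py => p.
by rewrite !inE => ->; rewrite orbT.
Qed.

(** The graph of h on A lies in P, with B as witness, so back-and-forth can start there. The
    automorphism may leave h on the rest of B. *)
Lemma limit_witness_extend A B (h : T -> T) :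
  limit_witness A B -> embedding_on B M M h ->
  exists g, isomorphism M M g /\ {in A, g =1 h}.
Proof.
move=> gB hB; pose s0 := [seq (x, h x) | x <- A].
have Ps0 : P s0.
  by exists A, B, h; split=> // _ /mapP[x xA ->].
have [||||g [gM gs]] := back_and_forth (M := M) (N := M) _ _ _ _ Ps0.
- move=> s [A' [B' [f [gB' [fI fP] sf]]]] p q /sf[pA <-] /sf[qA <-].
  have [/fsubsetP AB _] := gB'.
  by split=> [->//|/fI]; apply; apply: AB.
- move=> s [A' [B' [f [gB' [fI fP] sf]]]] r t ts.
  rewrite fP; last first.
    by case: gB' => /fsubsetP AB _ _ /mapP[p /ts/sf[/AB pB _] ->].
  rewrite map_tuple_comp; suff -> : map_tuple (f \o fst) t = map_tuple snd t by [].
  by apply: val_inj; apply/eq_in_map => p /ts/sf[].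
- move=> s /P_forth Ps x; have [y Py] := Ps x; exists ((x, y) :: s); split=> //.
    by move=> p ps; rewrite inE ps orbT.
  by exists y; rewrite mem_head.
- move=> s /P_back Ps y; have [x Px] := Ps y; exists ((x, y) :: s); split=> //.
    by move=> p ps; rewrite inE ps orbT.
  by exists x; rewrite mem_head.
exists g; split=> // x xA.
by apply: (gs (x, h x)); apply/mapP; exists x.
Qed.

(** The union of the two images in M, a finite substructure, is an amalgam. *)
Lemma amalgamable_in_limit (X U V : finType) (B : structure L U) (C : structure L V)
    (phi : X -> U) (psi : X -> V) f g :
  embedding B M f -> embedding C M g -> f \o phi =1 g \o psi ->
  amalgamable (age M) B C phi psi.
Proof.
move=> fB gC fg.
pose D := [fset f x | x : U] `|` [fset g y | y : V].
have fD x : f x \in D by rewrite inE in_imfset.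
have gD y : g y \in D by rewrite inE [X in _ || X]in_imfset ?orbT.
exists D, (substructure M D), (fun x => [` fD x]), (fun y => [` gD y]).
split; first exact: substructure_age.
- case: fB => fI fP; split=> [x y /(congr1 val)/fI //|r t].
  by rewrite fP /substructure map_tuple_comp.
- case: gC => gI gP; split=> [x y /(congr1 val)/gI //|r t].
  by rewrite gP /substructure map_tuple_comp.
- by move=> x; apply: val_inj; apply: fg.
Qed.

End Limit.

(** * Formulas and quantifier-free types *)

Section Formulas.
Variable L : signature.

Definition lift_ren n m (rho : 'I_n -> 'I_m) (i : 'I_n.+1) : 'I_m.+1 :=
  if unlift ord0 i is Some j then lift ord0 (rho j) else ord0.

Fixpoint ren n (phi : formula L n) : forall m, ('I_n -> 'I_m) -> formula L m :=
  match phi with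
  | FBot _ => fun m _ => FBot L m
  | FEq _ i j => fun m rho => FEq L (rho i) (rho j)
  | FRel _ r t => fun m rho => FRel (map_tuple rho t)
  | FImp _ p q => fun m rho => FImp (ren p rho) (ren q rho)
  | FAll _ p => fun m rho => FAll (ren p (lift_ren rho))
  end.

Lemma sat_ren T (M : structure L T) n (phi : formula L n) m (rho : 'I_n -> 'I_m) b :
  sat M (ren phi rho) b <-> sat M phi [tuple tnth b (rho i) | i < n].
Proof.
elim: phi m rho b => {n} [n|n i j|n r t|n p IHp q IHq|n p IHp] m rho b /=.
- by [].
- by rewrite !tnth_mktuple.
- rewrite map_tuple_comp; set t1 := map_tuple _ _; set t2 := map_tuple _ _.
  suff -> : t1 = t2 by [].
  by apply: eq_map_tuple => i; rewrite tnth_mktuple.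
- by rewrite IHp IHq.
- have E x : [tuple tnth (cons_tuple x b) (lift_ren rho i) | i < n.+1] =
             cons_tuple x [tuple tnth b (rho i) | i < n].
    apply: eq_from_tnth => i; rewrite tnth_mktuple /lift_ren.
    case: unliftP => [j ->|->]; last by rewrite !tnth0.
    by rewrite !tnthS tnth_mktuple.
  by split=> H x; move: (H x); rewrite IHp E.
Qed.

Definition FNot n (p : formula L n) := FImp p (FBot L n).
Definition FAnd n (p q : formula L n) := FNot (FImp p (FNot q)).
Definition FEx n (p : formula L n.+1) := FNot (FAll (FNot p)).
Definition FConj n (s : seq (formula L n)) :=
  foldr (@FAnd n) (FNot (FBot L n)) s.

Fixpoint FAlls n : formula L n -> formula L 0 :=
  if n is n'.+1 then fun p => FAlls (FAll p) else fun p => p.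

Fixpoint FExs k n : formula L (k + n) -> formula L n :=
  if k is k'.+1 then fun p => @FExs k' n (FEx p) else fun p => p.

Section Sat.
Variables (T : Type) (M : structure L T).

Lemma sat_FNot n (p : formula L n) a : sat M (FNot p) a <-> ~ sat M p a.
Proof. by []. Qed.

Lemma sat_FAnd n (p q : formula L n) a :
  sat M (FAnd p q) a <-> sat M p a /\ sat M q a.
Proof.
split=> [H|[Hp Hq] H]; last exact: (H Hp Hq).
by split; apply: contrapT => N; apply: H => Hp Hq; apply: N.
Qed.

Lemma sat_FEx n (p : formula L n.+1) a :
  sat M (FEx p) a <-> exists x, sat M p (cons_tuple x a).
Proof.
split=> [H|[x Hx] H]; last exact: (H x).
by apply: contrapT => N; apply: H => x Hx; apply: N; exists x.
Qed.

Lemma sat_FConj (I : eqType) (s : seq I) n (F : I -> formula L n) a :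
  sat M (FConj (map F s)) a <-> forall i, i \in s -> sat M (F i) a.
Proof.
elim: s => [|i s IH]; first by split=> // _ [].
rewrite sat_FAnd IH; split=> [[Hi Hs] j|H].
  by rewrite inE => /predU1P[->|/Hs].
by split=> [|j js]; apply: H; rewrite inE ?eqxx ?js ?orbT.
Qed.

Lemma sat_FAlls n (p : formula L n) :
  sat M (FAlls p) [tuple] <-> forall a, sat M p a.
Proof.
elim: n p => [|n IH] p /=; first by split=> [H a|//]; rewrite tuple0.
rewrite IH; split=> [H a|H a x]; last exact: H.
case/tupleP: a => x a; rewrite (_ : [tuple of _] = cons_tuple x a); first exact: H.
exact: val_inj.
Qed.

Lemma sat_FExs k n (p : formula L (k + n)) a :
  sat M (FExs p) a <-> exists d : k.-tuple T, sat M p (cat_tuple d a).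
Proof.
elim: k p => [|k IH] p /=.
  have E (d : 0.-tuple T) : cat_tuple d a = a by rewrite [d]tuple0; apply: val_inj.
  by split=> [H|[d]]; [exists [tuple]|]; rewrite E.
have E x (d : k.-tuple T) : cat_tuple [tuple of x :: d] a =
    cons_tuple x (cat_tuple d a) :> (k.+1 + n).-tuple T by exact: val_inj.
rewrite IH; split=> [[d /sat_FEx[x Hx]]|[d]].
  by exists [tuple of x :: d]; rewrite E.
by case/tupleP: d => x d; rewrite E => Hd; exists d; apply/sat_FEx; exists x.
Qed.

End Sat.

End Formulas.

Section Types.
Variable L : signature.

(** Equalities and atomic relations in m variables. The signature being finite, this is a finite
    type: there are finitely many quantifier-free types of m-tuples, and each is expressed by one
    formula. *)
Definition atom m : finType :=
  (('I_m * 'I_m) + {r : L & (arity r).-tuple 'I_m})%type.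

Definition holds T (A : structure L T) m (a : m.-tuple T) (x : atom m) : Prop :=
  match x with
  | inl ij => tnth a ij.1 = tnth a ij.2
  | inr rt => A (tag rt) (map_tuple (tnth a) (tagged rt))
  end.

Definition qftype T (A : structure L T) m (a : m.-tuple T) : {ffun atom m -> bool} :=
  [ffun x => `[< holds A a x >]].

Lemma qftypeP T U (A : structure L T) (B : structure L U) m
    (a : m.-tuple T) (b : m.-tuple U) :
  qftype A a = qftype B b <-> forall x, holds A a x <-> holds B b x.
Proof.
split=> [/ffunP E x|E].
  have := E x; rewrite !ffunE => Ex.
  by split=> /asboolP; [rewrite Ex|rewrite -Ex] => /asboolP.
by apply/ffunP => x; rewrite !ffunE; apply: asbool_equiv_eq.
Qed.

Lemma tuple_indices (T : eqType) n m (a : m.-tuple T) (t : n.-tuple T) :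
  {subset t <= a} -> exists u : n.-tuple 'I_m, map_tuple (tnth a) u = t.
Proof.
move=> ta; have /choice[u Hu] : forall i : 'I_n, exists j, tnth t i = tnth a j.
  by move=> i; apply/tnthP/ta/mem_tnth.
exists [tuple u i | i < n]; apply: eq_from_tnth => i.
by rewrite tnth_map tnth_mktuple -Hu.
Qed.

Lemma qftype_isomorphism T U (A : structure L T) (B : structure L U) g m
    (a : m.-tuple T) :
  isomorphism A B g -> qftype A a = qftype B (map_tuple g a).
Proof.
move=> [/bij_inj gI gP]; apply/qftypeP => -[[i j]|[r t]] /=.
  by rewrite !tnth_map; split=> [->//|/gI].
by rewrite gP map_tnth_map.
Qed.

Lemma qftype_map (T : choiceType) (A B : structure L T) m (a b : m.-tuple T) :
  qftype A a = qftype B b ->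
  exists h, embedding_on [fset x in tval a] A B h /\ map_tuple h a = b.
Proof.
(* An entry of a goes to the entry of b at the position of its first occurrence; the equality atoms
   make every other occurrence agree and give injectivity. *)
move=> /qftypeP E; exists (fun x => nth x b (index x a)).
have hE : map_tuple (fun x => nth x b (index x a)) a = b.
  apply: eq_from_tnth => i; rewrite tnth_map.
  have ia : index (tnth a i) a < m.
    by rewrite -[X in _ < X](size_tuple a) index_mem mem_tnth.
  rewrite -[index _ _]/(val (Ordinal ia)) -tnth_nth.
  apply/(E (inl (Ordinal ia, i))).
  by rewrite /= (tnth_nth (tnth a i)) nth_index ?mem_tnth.
split=> //; move: hE; set h := (fun x => _) => hE.
have hi i : h (tnth a i) = tnth b i by rewrite -hE tnth_map.
split=> [x y|r t tD].
  rewrite !inE => /tnthP[i ->] /tnthP[j ->]; rewrite !hi => bij.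
  exact/(E (inl (i, j))).
have /tuple_indices[u <-] : {subset t <= a} by move=> x /tD; rewrite inE.
rewrite map_tuple_comp; have := E (inr (Tagged _ u)); rewrite /holds /=.
by rewrite (eq_map_tuple (f := h \o tnth a) (g := tnth b)).
Qed.

End Types.

Section Interpretation.
Variables (L L' : signature) (I : forall r : L', formula L (arity r)).

(** One notion covers an expansion by defined relations and, through [atomic], the structure M
    itself; types in L' are thus always expressed by formulas of L. *)
Definition interp T (M : structure L T) : structure L' T := fun r => sat M (I r).

Definition atom_formula m (x : atom L' m) : formula L m :=
  match x with
  | inl ij => FEq L ij.1 ij.2
  | inr rt => ren (I (tag rt)) (tnth (tagged rt))
  end.

Lemma sat_atom_formula T (M : structure L T) m (x : atom L' m) a :
  sat M (atom_formula x) a <-> holds (interp M) a x.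
Proof.
case: x => [[i j]//|[r t]] /=; rewrite sat_ren.
rewrite (_ : mktuple _ = map_tuple (tnth a) t) //.
by apply: eq_from_tnth => i; rewrite tnth_mktuple tnth_map.
Qed.

Definition type_formula m (tau : {ffun atom L' m -> bool}) : formula L m :=
  FConj [seq (if tau x then atom_formula x else FNot (atom_formula x))
        | x <- enum (atom L' m)].

Lemma sat_type_formula T (M : structure L T) m tau (a : m.-tuple T) :
  sat M (type_formula tau) a <-> qftype (interp M) a = tau.
Proof.
rewrite sat_FConj; split=> [H|<- x _]; last first.
  by rewrite ffunE; case: asboolP => Hx; [|rewrite sat_FNot]; rewrite sat_atom_formula.
apply/ffunP => x; have := H x; rewrite mem_enum ffunE => /(_ isT).
by case: (tau x); rewrite ?sat_FNot sat_atom_formula => Hx; apply/asboolP.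
Qed.

Lemma interp_isomorphism T U (M : structure L T) (N : structure L U) g :
  isomorphism M N g -> isomorphism (interp M) (interp N) g.
Proof.
by move=> gi; split=> [|r t]; [case: gi | apply: sat_isomorphism].
Qed.

End Interpretation.

Definition atomic (L : signature) (r : L) : formula L (arity r) :=
  FRel (ord_tuple (arity r)).

Lemma sat_atomic (L : signature) T (M : structure L T) (r : L) t :
  sat M (atomic r) t = M r t.
Proof.
rewrite /=; congr (M r); apply: eq_from_tnth => i.
by rewrite tnth_map tnth_ord_tuple.
Qed.

Lemma interp_atomic (L : signature) T (M : structure L T) :
  interp (@atomic L) M = M.
Proof.
apply: functional_extensionality_dep => r; apply: funext => t.
exact: sat_atomic.
Qed.

Definition expansion_formula (L : signature) n (ar : 'I_n -> nat)
    (phi : forall i, formula L (ar i)) :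
    forall r : expanded_signature L ar, formula L (arity r) :=
  fun s => match s return formula L (@arity (expanded_signature L ar) s) with
           | inl r => atomic r
           | inr i => phi i
           end.

Lemma interp_expansion (L : signature) n (ar : 'I_n -> nat)
    (phi : forall i, formula L (ar i)) T (M : structure L T) :
  interp (expansion_formula phi) M = expansion M phi.
Proof.
apply: functional_extensionality_dep => -[r|i] //; apply: funext => t.
exact: sat_atomic.
Qed.

(** * Definability of orbits *)

Section OrbitFormula.
Variables (L : signature) (T : countType) (M : structure L T).
Hypothesis limM : forall A, exists B, limit_witness M A B.

Definition conjugate n (a b : n.-tuple T) : Prop :=
  exists g, isomorphism M M g /\ map_tuple g a = b.

Lemma orbit_formula n (a : n.-tuple T) :
  exists chi : formula L n, forall b, sat M chi b <-> conjugate a b.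
Proof.
have [B gB] := limM [fset x in tval a].
(* The witness B is listed before a because [FExs] quantifies over the first coordinates. *)
pose d := in_tuple (enum_fset B); pose c := cat_tuple d a.
exists (FExs (type_formula (@atomic L) (qftype M c))) => b.
rewrite sat_FExs; split=> [[y]|[g [gM <-]]]; last first.
  exists (map_tuple g d); apply/sat_type_formula; rewrite interp_atomic.
  rewrite [RHS](qftype_isomorphism _ gM); congr qftype.
  by apply: val_inj; rewrite /= map_cat.
rewrite sat_type_formula interp_atomic => /esym/qftype_map[h [hc hE]].
have aB : {subset a <= B}.
  by move=> x xa; case: gB => /fsubsetP + _; apply; rewrite inE.
have {}hc : embedding_on B M M h.
  apply: embedding_onS hc; apply/fsubsetP => x xB.
  by rewrite !inE (xB : x \in enum_fset B).
have [g [gM gh]] := limit_witness_extend limM gB hc.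
exists g; split=> //; apply: val_inj => /=.
have /eqP := congr1 val hE; rewrite /= map_cat eqseq_cat ?size_map ?size_tuple //.
move=> /andP[_ /eqP <-]; apply/eq_in_map => x xa.
by apply: gh; rewrite inE.
Qed.

End OrbitFormula.

(** * Homogenizable structures *)

Section Conjugate.
Variables (L : signature) (T : countType) (M : structure L T).

Lemma conjugate_refl n (a : n.-tuple T) : conjugate M a a.
Proof.
exists id; split; last exact: map_tuple_id.
by split=> [|r t]; [exists id | rewrite map_tuple_id].
Qed.

Lemma conjugate_sym n (a b : n.-tuple T) : conjugate M a b -> conjugate M b a.
Proof.
move=> [g [/isomorphism_inv[h [hM gK _]] <-]]; exists h; split=> //.
exact: map_tuple_cancel.
Qed.

Lemma conjugate_trans n (a b c : n.-tuple T) :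
  conjugate M a b -> conjugate M b c -> conjugate M a c.
Proof.
move=> [g [gM <-]] [h [hM <-]]; exists (h \o g).
by split; [apply: isomorphism_comp gM hM | rewrite map_tuple_comp].
Qed.

Lemma sat_conjugate n (phi : formula L n) (a b : n.-tuple T) :
  conjugate M a b -> sat M phi a <-> sat M phi b.
Proof. by move=> [g [gM <-]]; apply: sat_isomorphism. Qed.

Lemma ultrahomogeneous_qftype : ultrahomogeneous M ->
  forall n (a b : n.-tuple T), qftype M a = qftype M b -> conjugate M a b.
Proof.
move=> hom n a b /qftype_map[h [ha <-]].
have [|e [eE eh]] := embedding_restrict (E := h @` [fset x in tval a]) ha.
  by move=> x xa; apply: in_imfset.
have [|g [gM ge]] := hom _ _ e.
  split; last by case: eE.
  apply: inj_card_bij; first by case: eE.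
  by rewrite -!cardfE leq_imfset_card.
exists g; split=> //; apply: val_inj; apply/eq_in_map => x xa.
have xA : x \in [fset x in tval a] by rewrite inE.
by rewrite (ge [` xA]) eh.
Qed.

End Conjugate.

Lemma qftype_reindex (L : signature) T U (A : structure L T) (B : structure L U)
    m n (a : m.-tuple T) (b : m.-tuple U) (rho : 'I_n -> 'I_m) :
  qftype A a = qftype B b ->
  qftype A [tuple tnth a (rho i) | i < n] = qftype B [tuple tnth b (rho i) | i < n].
Proof.
move=> /qftypeP E; apply/qftypeP => -[[i j]|[r t]].
  by rewrite /= !tnth_mktuple; apply: (E (inl (rho i, rho j))).
have := E (inr (Tagged _ (map_tuple rho t))); rewrite /= !map_tuple_comp.
have R V (w : m.-tuple V) :
    map_tuple (tnth w \o rho) t = map_tuple (tnth [tuple tnth w (rho i) | i < n]) t.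
  by apply: eq_map_tuple => i; rewrite tnth_mktuple.
by rewrite !R.
Qed.

Lemma qftype_behead (L : signature) T U (A : structure L T) (B : structure L U)
    m (a : m.-tuple T) (b : m.-tuple U) x y :
  qftype A (cons_tuple x a) = qftype B (cons_tuple y b) ->
  qftype A a = qftype B b.
Proof.
move=> /(qftype_reindex (lift ord0)).
have E V z (c : m.-tuple V) : [tuple tnth (cons_tuple z c) (lift ord0 i) | i < m] = c.
  by apply: eq_from_tnth => i; rewrite tnth_mktuple tnthS.
by rewrite !E.
Qed.

(** * Omega-categoricity of homogenizable structures *)

Section HomogeneousInterpretation.
Variables (L L' : signature) (I : forall r : L', formula L (arity r)).
Variables (T U : countType) (M : structure L T) (N : structure L U).
Hypothesis hom : ultrahomogeneous (interp I M).
Hypothesis MN : elementarily_equivalent M N.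

Let M' := interp I M.
Let N' := interp I N.

(** By homogeneity, if one tuple of type p in M extends to type q, then all do. This is a sentence
    of L, so it passes to N. *)
Let extension_transfer m (a : m.-tuple T) x (b : m.-tuple U) :
  qftype M' a = qftype N' b ->
  exists y, qftype M' (cons_tuple x a) = qftype N' (cons_tuple y b).
Proof.
move=> ab; pose p := qftype M' a; pose q := qftype M' (cons_tuple x a).
have : sat M (FAlls (FImp (type_formula I p) (FEx (type_formula I q)))) [tuple].
  apply/sat_FAlls => a' /sat_type_formula a'p; apply/sat_FEx.
  have [g [gM <-]] := ultrahomogeneous_qftype hom (esym a'p).
  exists (g x); apply/sat_type_formula.
  rewrite [RHS](qftype_isomorphism _ gM); congr qftype; exact: val_inj.
move=> /MN/sat_FAlls/(_ b) H.
have /H/sat_FEx[y /sat_type_formula yq] : sat N (type_formula I p) b.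
  exact/sat_type_formula.
by exists y.
Qed.

Let realized_transfer m (b : m.-tuple U) : exists a, qftype M' a = qftype N' b.
Proof.
apply: contrapT => nex.
have : sat M (FAlls (FNot (type_formula I (qftype N' b)))) [tuple].
  by apply/sat_FAlls => a /sat_type_formula ab; apply: nex; exists a.
by move=> /MN/sat_FAlls/(_ b); apply; apply/sat_type_formula.
Qed.

Lemma interp_isomorphic : isomorphic M' N'.
Proof.
pose fs (s : seq (T * U)) := map_tuple fst (in_tuple s).
pose sn (s : seq (T * U)) := map_tuple snd (in_tuple s).
pose P s := qftype M' (fs s) = qftype N' (sn s).
have consfs x y s : fs ((x, y) :: s) = cons_tuple x (fs s) by apply: val_inj.
have conssn x y s : sn ((x, y) :: s) = cons_tuple y (sn s) by apply: val_inj.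
(* The empty tuples must have the same type too, since relation symbols may be nullary. *)
have P0 : P [::].
  have [a aE] := realized_transfer (sn [::]); apply: etrans aE; congr qftype.
  by rewrite [RHS]tuple0; apply: tuple0.
have [||||g [gMN _]] := back_and_forth (M := M') (N := N') _ _ _ _ P0; last by exists g.
- move=> s /qftypeP E p q /seq_tnthP[i ->] /seq_tnthP[j ->].
  by have := E (inl (i, j)); rewrite /= !tnth_map.
- move=> s /qftypeP E r t ts.
  have [u <-] : exists u, map_tuple (tnth (in_tuple s)) u = t by apply: tuple_indices.
  by have := E (inr (Tagged _ u)); rewrite /= !map_tnth_map.
- move=> s Ps x; have [y xy] := extension_transfer x Ps.
  exists ((x, y) :: s); split; first by rewrite /P consfs conssn.
    by move=> p ps; rewrite inE ps orbT.
  by exists y; rewrite mem_head.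
(* Nothing is known yet about homogeneity of N. The type of the enlarged tuple of N is realized
   somewhere in M, and an automorphism moves this realization onto the given tuple of M. *)
- move=> s Ps y; have [c] := realized_transfer (cons_tuple y (sn s)).
  case/tupleP: c => x' a' x'y.
  have a's : qftype M' a' = qftype M' (fs s).
    rewrite Ps; apply: (@qftype_behead _ _ _ _ _ _ _ _ x' y).
    by rewrite -x'y; congr qftype; exact: val_inj.
  have [g [gM ga']] := ultrahomogeneous_qftype hom a's.
  exists ((g x', y) :: s); split.
  + rewrite /P consfs conssn -x'y [RHS](qftype_isomorphism _ gM); congr qftype.
    by rewrite -ga'; apply: val_inj.
  + by move=> p ps; rewrite inE ps orbT.
  + by exists (g x'); rewrite mem_head.
Qed.

End HomogeneousInterpretation.

Lemma expansion_isomorphism (L : signature) n (ar : 'I_n -> nat)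
    (phi : forall i, formula L (ar i)) T U (M : structure L T) (N : structure L U) g :
  isomorphism (expansion M phi) (expansion N phi) g -> isomorphism M N g.
Proof. by move=> [gb gP]; split=> // r t; apply: (gP (inl r)). Qed.

Lemma homogenizable_omega_categorical (L : signature) (T : countType)
    (M : structure L T) : homogenizable M -> omega_categorical M.
Proof.
move=> [n [ar [phi]]]; rewrite -interp_expansion => hom U N MN.
have [g] := interp_isomorphic hom MN.
by rewrite !interp_expansion => /expansion_isomorphism gMN; exists g.
Qed.

(** * SEAP for homogenizable structures *)

Section HomogenizableSEAP.
Variables (L : signature) (T : countType) (M : structure L T).
Hypothesis limM : forall A, exists B, limit_witness M A B.
Variables (n : nat) (ar : 'I_n.+1 -> nat) (phi : forall i, formula L (ar i)).
Hypothesis hom : ultrahomogeneous (expansion M phi).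

Lemma expansion_conjugate m (a b : m.-tuple T) :
  qftype (expansion M phi) a = qftype (expansion M phi) b -> conjugate M a b.
Proof.
move=> /(ultrahomogeneous_qftype hom)[g [gM gab]]; exists g; split=> //.
exact: expansion_isomorphism gM.
Qed.

(** All tuples of one type in the expansion are translates of a single one, and a translate of its
    witness isolates each of them. There are finitely many types, hence a common bound on the
    sizes. *)
Lemma isolating_bound m : exists k, forall a : m.-tuple T, exists D,
  [/\ #|` D| <= k, {subset a <= D}
    & forall h, embedding_on D M M h -> conjugate M a (map_tuple h a)].
Proof.
pose Q tau (D : {fset T}) := forall a : m.-tuple T,
  qftype (expansion M phi) a = tau -> exists g,
  [/\ isomorphism M M g, {subset a <= g @` D}
    & forall h, embedding_on (g @` D) M M h -> conjugate M a (map_tuple h a)].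
have /choice[D HD] : forall tau, exists D, Q tau D.
  move=> tau; have [[a atau]|nex] := lem (exists a, qftype (expansion M phi) a = tau);
    last by exists fset0 => a atau; case: nex; exists a.
  have [B gB] := limM [fset x in tval a].
  exists B => b btau.
  have [g [gM gab]] := expansion_conjugate (etrans atau (esym btau)).
  exists g; split=> //.
    move=> x; rewrite -gab => /mapP[y ya ->]; apply: in_imfset => /=.
    by case: gB => /fsubsetP + _; apply; rewrite inE.
  move=> h hD; have hg : embedding_on B M M (h \o g).
    case: hD gM => hI hP [/bij_inj gI gP].
    split=> [x y xB yB /hI|r t tB].
      by move=> /(_ (in_imfset _ _ xB) (in_imfset _ _ yB))/gI.
    rewrite gP hP ?map_tuple_comp // => _ /mapP[x /tB xB ->].
    exact: in_imfset.
  have [k [kM kh]] := limit_witness_extend limM gB hg.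
  (* The passage from b to its image under h goes back to a by the inverse of g and then forward by
     k, which agrees with h after g on the entries of a. *)
  apply: conjugate_trans (conjugate_sym (ex_intro _ g (conj gM gab))) _.
  exists k; split=> //; rewrite -gab map_tuple_comp.
  by apply: val_inj; apply/eq_in_map => x xa; apply: kh; rewrite inE.
exists (\max_tau #|` D tau|) => a.
have [g [gM ag gh]] := HD _ a erefl.
exists (g @` D (qftype (expansion M phi) a)); split=> //.
by apply: leq_trans (leq_imfset_card _ _ _) (leq_bigmax _).
Qed.

(** B0 is the image of B enlarged by an isolating set for the image of v, so that the orbit of v no
    longer depends on how B0 is embedded in M. *)
Lemma isolating_extension m : exists k, forall (U : finType) (B : structure L U) f
    (v : m.-tuple U), embedding B M f ->
  exists (U0 : finType) (B0 : structure L U0) (iB : U -> U0),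
    [/\ age M B0, embedding B B0 iB, #|U0| - #|U| <= k
      & forall h, embedding B0 M h ->
          conjugate M (map_tuple f v) (map_tuple (h \o iB) v)].
Proof.
have [k Hk] := isolating_bound m; exists k => U B f v [fI fP].
have [D [Dk vD HD]] := Hk (map_tuple f v).
pose W := [fset f x | x : U] `|` D.
have fW x : f x \in W by rewrite inE in_imfset.
exists W, (substructure M W), (fun x => [` fW x]); split.
- exact: substructure_age.
- split=> [x y /(congr1 val)/fI //|r t].
  by rewrite fP /substructure map_tuple_comp.
- rewrite -cardfE leq_subLR cardfsU; apply: leq_trans (leq_subr _ _) _.
  apply: leq_add Dk; apply: leq_trans (leq_imfset_card _ _ _) _.
  by rewrite -cardE.
- move=> h; have [h' hh'] := extend_map h.
  move=> /(embedding_onP _ _ hh')/(embedding_onS (fsubsetUr _ _))/HD.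
  rewrite map_tuple_comp (eq_map_tuple (f := h' \o f) (g := h \o fun x => [` fW x])) //.
  by move=> x; rewrite /= hh'.
Qed.

Lemma embeddings_conjugate (X : finType) (A : structure L X) f g :
  embedding A M f -> embedding A M g ->
  (forall i (v : (ar i).-tuple X),
     sat M (phi i) (map_tuple f v) <-> sat M (phi i) (map_tuple g v)) ->
  exists s, isomorphism M M s /\ s \o f =1 g.
Proof.
move=> [fI fP] [gI gP] fg; pose e := enum_tuple X.
have [|s [sM sfg]] := @expansion_conjugate _ (map_tuple f e) (map_tuple g e).
  apply/qftypeP => -[[i j]|[[r|i] t]] /=.
  - by rewrite !tnth_map; split=> [/fI ->|/gI ->].
  - by rewrite !map_tnth_map -fP gP.
  - by rewrite !map_tnth_map.
exists s; split=> // x.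
have /tnthP[i ->] : x \in e by rewrite mem_enum.
by have := congr1 (fun t => tnth t i) sfg; rewrite !tnth_map.
Qed.

Lemma homogenizable_SEAP : SEAP (age M).
Proof.
have /choice[K HK] : forall i, exists k, _ := fun i => isolating_extension (ar i).
(* The bounds in [SEAP_] are strict, hence the successors. *)
exists (\max_i ar i).+1, (\max_i K i).+1.
move=> X TB TC A B C phi0 psi0 _ [f fB] [g gC] phiB psiC nam.
(* If all the formulas agreed on A under the two embeddings, an automorphism would carry one
   embedding of A to the other, and M would provide an amalgam. *)
have [i [v nv]] : exists i (v : (ar i).-tuple X),
    ~ (sat M (phi i) (map_tuple (f \o phi0) v) <->
       sat M (phi i) (map_tuple (g \o psi0) v)).
  apply: contrapT => nex; apply: nam.
  have [|s [sM sfg]] :=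
    embeddings_conjugate (embedding_comp phiB fB) (embedding_comp psiC gC).
    by move=> i v; apply: contrapT => nv; apply: nex; exists i, v.
  apply: (amalgamable_in_limit (f := s \o f)) gC sfg.
  exact: embedding_comp fB (isomorphism_embedding sM).
have [TB0 [B0 [iB [B0M BB0 cB HB]]]] := HK i _ _ _ (map_tuple phi0 v) fB.
have [TC0 [C0 [iC [C0M CC0 cC HC]]]] := HK i _ _ _ (map_tuple psi0 v) gC.
exists [fset x in tval v], TB0, TC0, B0, C0, iB, iC; split; split=> //.
- exists (f \o phi0 \o val).
  have [vI vP] := embedding_comp phiB fB.
  split=> [x y /vI/val_inj //|r t]; rewrite -map_tuple_comp -vP.
  by [].
- rewrite ltnS card_fseq; apply: leq_trans (size_undup _) _.
  by rewrite size_tuple; apply: leq_bigmax.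
- by apply: leq_trans cB _; apply: leq_bigmax.
- by apply: leq_trans cC _; apply: leq_bigmax.
(* Inside an amalgam, embedded in M by j, the two copies of v coincide. Since B0 and C0 fix their
   orbits, [phi i] would have the same truth value at both original images of v. *)
- move=> [U [D [beta [gamma [[j jM] bD gD bg]]]]]; apply: nv.
  have := sat_conjugate (phi i) (HB _ (embedding_comp bD jM)).
  have := sat_conjugate (phi i) (HC _ (embedding_comp gD jM)).
  rewrite !map_tuple_comp => -> ->; set t1 := map_tuple _ _; set t2 := map_tuple _ _.
  suff -> : t1 = t2 by [].
  apply: val_inj; apply/eq_in_map => x xv /=.
  have xS : x \in [fset x in tval v] by rewrite inE.
  by have := bg [` xS]; rewrite /= => ->.
Qed.

End HomogenizableSEAP.

(** * Skolem ultrapowers and finiteness of the number of orbits *)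

Section Coding.
Variable L : signature.

(** Formulas are coded so that Skolem functions can be numbered. The number of variables is not
    stored; [decode] receives it from the length of the parameter list. *)
Fixpoint code n (phi : formula L n) : GenTree.tree nat :=
  match phi with
  | FBot _ => GenTree.Node 0 [::]
  | FEq n i j => GenTree.Leaf (choice.pickle (inl (i, j) : atom L n))
  | FRel n r t => GenTree.Leaf (choice.pickle (inr (Tagged _ t) : atom L n))
  | FImp _ p q => GenTree.Node 0 [:: code p; code q]
  | FAll _ p => GenTree.Node 0 [:: code p]
  end.

Fixpoint decode (t : GenTree.tree nat) n : formula L n :=
  match t with
  | GenTree.Leaf k =>
      match choice.unpickle k : option (atom L n) with
      | Some (inl ij) => FEq L ij.1 ij.2
      | Some (inr rt) => FRel (tagged rt)
      | None => FBot L n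
      end
  | GenTree.Node _ [:: p; q] => FImp (decode p n) (decode q n)
  | GenTree.Node _ [:: p] => FAll (decode p n.+1)
  | GenTree.Node _ _ => FBot L n
  end.

Lemma codeK n (phi : formula L n) : decode (code phi) n = phi.
Proof.
elim: phi => {n} /= [//|n i j|n r t|n p -> q -> //|n p -> //];
  by rewrite choice.pickleK.
Qed.

End Coding.

Section SkolemUltrapower.
Variables (L : signature) (T : countType) (M : structure L T) (x0 : T).
Variables (n : nat) (c : nat -> n.-tuple T).
Variables (F : set_system nat) (UF : UltraFilter F).
Local Open Scope classical_set_scope.

(** Skolem functions pick counterexamples because the universal quantifier is the primitive one; the
    value is [x0] when there is no counterexample. *)
Definition witness (k : nat) (s : seq T) : T :=
  if choice.unpickle k is Some p then
    if pselect (exists x, ~ sat M (decode L p (size s).+1) (cons_tuple x (in_tuple s)))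
      is left e then sval (cid e) else x0
  else x0.

Lemma witnessP m (phi : formula L m.+1) (b : m.-tuple T) x :
  ~ sat M phi (cons_tuple x b) ->
  ~ sat M phi (cons_tuple (witness (choice.pickle (code phi)) b) b).
Proof.
case: b => s sz; have e := eqP sz; case: m / e in phi sz *.
have -> : Tuple sz = in_tuple s by apply: val_inj.
move=> nx; rewrite /witness choice.pickleK codeK.
by case: pselect => [ex|[]]; [case: cid | exists x].
Qed.

(* Trees serve as Skolem terms: leaf j is the j-th coordinate of the sequence c,
   and node k applied to ts is a counterexample to the universal closure in
   variable 0 of the formula with code k, at the parameters ts. *)
Fixpoint eval (t : GenTree.tree nat) (i : nat) : T :=
  match t with
  | GenTree.Leaf j => nth x0 (c i) j
  | GenTree.Node k ts => witness k [seq eval t i | t <- ts]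
  end.

Definition equ (t s : GenTree.tree nat) : bool :=
  `[< F [set i | eval t i = eval s i] >].

(** The quotient by equality almost everywhere is formed by canonical representatives, so that it is
    a subtype of the trees and inherits countability. *)
Definition rep t := choose (equ t) t.

Lemma equ_refl t : equ t t.
Proof. by apply/asboolP; apply: filterE. Qed.

Lemma equ_rep t : equ t (rep t).
Proof. exact: chooseP (equ_refl t). Qed.

Lemma equ_eq_rep t s : equ t s -> rep t = rep s.
Proof.
move=> ts; rewrite /rep (choose_id (equ_refl t) ts); apply: eq_choose => u.
move/asboolP: ts => ts; apply/asboolP/asboolP; apply: filterS2 ts.
  by move=> i /= -> .
by move=> i /= ->.
Qed.

Definition ultra : countType := {t : GenTree.tree nat | rep t == t}.

Definition class t : ultra :=
  exist _ (rep t) (introT eqP (esym (equ_eq_rep (equ_rep t)))).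

Definition value i (w : ultra) : T := eval (val w) i.

Definition ultra_structure : structure L ultra :=
  fun r t => F [set i | @M r (map_tuple (value i) t)].

(** The theorem of Łoś for this submodel of the ultrapower. Implication uses that F is an
    ultrafilter, and the quantifier uses closure under Skolem terms. *)
Lemma los m (phi : formula L m) (a : m.-tuple ultra) :
  sat ultra_structure phi a <-> F [set i | sat M phi (map_tuple (value i) a)].
Proof.
elim: phi a => {m} [m|m i j|m r t|m p IHp q IHq|m p IHp] a /=.
- split=> // F0; exact: filter_not_empty F0.
- split=> [ij|Fij]; first by apply: filterE => k /=; rewrite !tnth_map ij.
  have ij : equ (val (tnth a i)) (val (tnth a j)).
    by apply/asboolP; apply: filterS Fij => k /=; rewrite !tnth_map.
  apply: val_inj; rewrite -(eqP (valP (tnth a i))) -(eqP (valP (tnth a j))).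
  exact: equ_eq_rep.
- rewrite /ultra_structure.
  by split; apply: filterS => k /=; rewrite map_tnth_map.
- rewrite IHp IHq; split=> [H|Fi Fp]; last by apply: filterS2 Fi Fp => i /=; apply.
  have [/H|nFp] := in_ultra_setVsetC [set i | sat M p (map_tuple (value i) a)] UF.
    by apply: filterS => i /= ? _.
  by apply: filterS nFp => i /=.
- have E w i : map_tuple (value i) (cons_tuple w a) =
      cons_tuple (value i w) (map_tuple (value i) a) by apply: val_inj.
  split=> [H|Fa w]; last by apply/IHp; apply: filterS Fa => i /=; rewrite E; apply.
  (* The term t evaluates to a counterexample to p at each index that has one. As p holds at the
     class of t, almost no index has one. *)
  pose t := GenTree.Node (choice.pickle (code p)) (map val a).
  have /asboolP Ft := equ_rep t.
  have /IHp Fw := H (class t).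
  apply: filterS2 Ft Fw => i /= ti; rewrite E /value /= -ti => Hp x.
  apply: contrapT => /witnessP; apply; move: Hp => /=.
  by rewrite -map_comp.
Qed.

Lemma ultra_elementary : elementarily_equivalent M ultra_structure.
Proof.
move=> phi; rewrite los; split=> [H|].
  by apply: filterE => i /=; rewrite tuple0.
by move=> /filter_ex[i /=]; rewrite tuple0.
Qed.

Lemma ultra_tuple : exists d : n.-tuple ultra, forall phi : formula L n,
  sat ultra_structure phi d -> F [set i | sat M phi (c i)].
Proof.
(* The tuple d is the class of the sequence c. Passing to representatives makes its values equal to
   those of c only almost everywhere, one coordinate at a time; n being finite, these sets can be
   intersected. *)
pose d := [tuple class (GenTree.Leaf (val j)) | j < n]; exists d => phi /los Fd.
have Fj (j : 'I_n) : F [set i | value i (tnth d j) = tnth (c i) j].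
  have /asboolP := equ_rep (GenTree.Leaf (val j)); apply: filterS => i /=.
  by rewrite tnth_mktuple /value /= => <-; rewrite -tnth_nth.
have Fall : F [set i | forall j : 'I_n, value i (tnth d j) = tnth (c i) j].
  exact: filter_forall.
apply: filterS2 Fd Fall => i /= + dE.
rewrite (_ : map_tuple (value i) d = c i) //.
by apply: eq_from_tnth => j; rewrite tnth_map.
Qed.

End SkolemUltrapower.

(** * Finiteness of the number of orbits *)

Section Ryll_Nardzewski.
Variables (L : signature) (T : countType) (M : structure L T).
Hypothesis limM : forall A, exists B, limit_witness M A B.
Hypothesis catM : omega_categorical M.
Local Open Scope classical_set_scope.

Lemma finitely_many_orbits n : exists s : seq (n.-tuple T),
  forall a, exists2 b, b \in s & conjugate M b a.
Proof.
(* The Skolem construction needs a default element, so an empty domain is treated apart. *)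
have [[x0 _]|nT] := lem (exists x : T, True); last first.
  have eqT (a b : n.-tuple T) : a = b.
    by apply: eq_from_tnth => i; case: nT; exists (tnth a i).
  have [[a _]|na] := lem (exists a : n.-tuple T, True); last first.
    by exists [::] => a; case: na; exists a.
  exists [:: a] => b; exists a; rewrite ?mem_head // (eqT b a).
  exact: conjugate_refl.
apply: contrapT => nex.
(* The N-th tuple avoids the orbits of all tuples with code below N, so the sequence eventually
   leaves each orbit. *)
have /choice[c Hc] : forall N, exists a : n.-tuple T, forall b,
    choice.pickle b < N -> ~ conjugate M b a.
  move=> N; apply: contrapT => na; apply: nex.
  exists (pmap choice.unpickle (iota 0 N)) => a; apply: contrapT => nb; apply: na.
  exists a => b bN ba; apply: nb; exists b => //.
  rewrite mem_pmap; apply/mapP; exists (choice.pickle b); first by rewrite mem_iota.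
  by rewrite choice.pickleK.
have [F [UF eF]] := ultraFilterLemma eventually_filter.
have [g gMN] := catM (ultra_elementary M x0 c UF).
have [h [hNM hK gK]] := isomorphism_inv gMN.
have [d Hd] := ultra_tuple M x0 c UF.
(* The image of d in M has an orbit like any other: its formula puts almost every [c i] in that
   orbit, against the choice of c for large i. *)
have [chi Hchi] := orbit_formula limM (map_tuple h d).
have Fchi : F [set i | sat M chi (c i)].
  by apply: Hd; apply/(sat_isomorphism hNM)/Hchi/conjugate_refl.
have Fev : F [set i | choice.pickle (map_tuple h d) < i].
  by apply: eF; exists (choice.pickle (map_tuple h d)).+1.
have [i [/Hchi ci hi]] := filter_ex (filterI Fchi Fev).
exact: Hc hi ci.
Qed.

End Ryll_Nardzewski.

(** * SEAP implies homogenizability *)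

Section SEAPHomogenizable.
Variables (L : signature) (T : countType) (M : structure L T).
Hypothesis limM : forall A, exists B, limit_witness M A B.

Lemma orbit_representatives k : omega_categorical M ->
  exists s : seq {m : nat & m.-tuple T}, forall m (a : m.-tuple T), m < k ->
  exists2 b : m.-tuple T, Tagged (fun m => m.-tuple T) b \in s & conjugate M b a.
Proof.
move=> catM; elim: k => [|k [s Hs]]; first by exists [::].
have [u Hu] := finitely_many_orbits limM catM k.
exists ([seq Tagged (fun m => m.-tuple T) b | b <- u] ++ s) => m a.
rewrite ltnS leq_eqVlt => /predU1P[mk|/(Hs _ a)[b bs ba]]; last first.
  by exists b; rewrite // mem_cat bs orbT.
case: k / mk in s Hs u Hu *; have [b bu ba] := Hu a.
by exists b; rewrite // mem_cat map_f.
Qed.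

Lemma conjugate_subsets_extend k l (A B : {fset T}) (f : A -> B) : SEAP_ (age M) k l ->
  isomorphism (substructure M A) (substructure M B) f ->
  (forall m (v : m.-tuple A), m < k ->
     conjugate M (map_tuple val v) (map_tuple (val \o f) v)) ->
  exists g, isomorphism M M g /\ forall x : A, g (val x) = val (f x).
Proof.
move=> seap fAB conj.
have [A1 gA] := limM A; have [B1 gB] := limM B.
have [/fsubsetP AA1 extA] := gA; have [/fsubsetP BB1 extB] := gB.
pose phi (x : A) : A1 := [` AA1 _ (valP x)].
pose psi (x : A) : B1 := [` BB1 _ (valP (f x))].
have ephi : embedding (substructure M A) (substructure M A1) phi.
  split=> [x y /(congr1 val) E|r t]; first exact: val_inj.
  by rewrite /substructure map_tuple_comp.
have epsi : embedding (substructure M A) (substructure M B1) psi.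
  case: fAB => /bij_inj fI fP.
  split=> [x y /(congr1 val) E|r t]; first exact/fI/val_inj.
  by rewrite fP /substructure !map_tuple_comp.
(* An amalgam of the two witnesses embeds in M; each witness is then moved into it by an
   automorphism, and one automorphism followed by the inverse of the other extends f. *)
have [am|nam] :=
  lem (amalgamable (age M) (substructure M A1) (substructure M B1) phi psi).
  case: am => U [D [beta [gamma [[j jM] bD gD bg]]]].
  have [b bE] := extend_map (j \o beta); have [c cE] := extend_map (j \o gamma).
  have [g [gM gb]] := limit_witness_extend limM gA
    ((embedding_onP _ _ bE).1 (embedding_comp bD jM)).
  have [h [/isomorphism_inv[h' [h'M hK _]] hc]] := limit_witness_extend limM gB
    ((embedding_onP _ _ cE).1 (embedding_comp gD jM)).
  exists (h' \o g); split; first exact: isomorphism_comp gM h'M.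
  move=> x; rewrite /= (gb _ (valP x)) -[RHS]hK (hc _ (valP (f x))).
  by have := congr1 j (bg x); rewrite -[b _](bE (phi x)) -[c _](cE (psi x)) /= => ->.
have [S [TB0 [TC0 [B0 [C0 [iB [iC]]]]]]] := seap _ _ _ _ _ _ phi psi
  (substructure_age M A) (substructure_age M A1) (substructure_age M B1) ephi epsi nam.
case=> [[_ B0M C0M eB eC] [Sk _ _ []]].
(* The obstruction cannot exist: B0 and C0 embed in M over A and B, and conjugacy of S with its
   image under f aligns the two embeddings on S, which amalgamates them. *)
have [b [bM bE]] := extA _ _ _ B0M eB; have [c [cM cE]] := extB _ _ _ C0M eC.
have [g [gM gE]] := conj _ (in_tuple (enum_fset S)) Sk.
apply: (amalgamable_in_limit (f := g \o b)) cM _.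
  exact: embedding_comp bM (isomorphism_embedding gM).
move=> x /=; rewrite (bE (phi (val x)) (valP (val x))).
rewrite (cE (psi (val x)) (valP (f (val x)))) /=.
have xS : val x \in enum_fset S by apply: valP.
have /tnthP[i xi] : val x \in in_tuple (enum_fset S) by [].
by have := congr1 (fun t => tnth t i) gE; rewrite !tnth_map -xi.
Qed.

Lemma SEAP_homogenizable :
  omega_categorical M -> SEAP (age M) -> homogenizable M.
Proof.
move=> catM [k [l seap]].
have [s Hs] := orbit_representatives k catM.
(* [homogenizable] asks for at least one formula, so the list of representatives, possibly empty, is
   padded by the empty tuple. *)
pose rep (i : 'I_(size s).+1) := nth (Tagged (fun m => m.-tuple T) [tuple]) s i.
pose phi i := sval (cid (orbit_formula limM (tagged (rep i)))).
have phiP i b : sat M (phi i) b <-> conjugate M (tagged (rep i)) b.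
  exact: (svalP (cid (orbit_formula limM (tagged (rep i))))).
exists (size s), (fun i => tag (rep i)), phi => A B f [fb fP].
have fAB : isomorphism (substructure M A) (substructure M B) f.
  by split=> // r t; apply: (fP (inl r)).
have [m v mk|g [gM gf]] := @conjugate_subsets_extend k l _ _ _ seap fAB; last first.
  exists g; split=> //; rewrite -interp_expansion.
  exact: interp_isomorphism.
(* The symbol naming the orbit of b holds at v, hence at its image under f, so that both are
   conjugate to b. *)
have [b bs ba] := Hs _ (map_tuple val v) mk.
have fPi i (t : (tag (rep i)).-tuple A) :
    conjugate M (tagged (rep i)) (map_tuple val t) ->
    conjugate M (tagged (rep i)) (map_tuple (val \o f) t).
  by move=> /phiP/(fP (inr i))/phiP; rewrite map_tuple_comp.
have ltis : index (Tagged (fun m => m.-tuple T) b) s < (size s).+1.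
  by rewrite ltnS index_size.
have := fPi (Ordinal ltis); rewrite /rep nth_index // => /(_ v ba).
exact/conjugate_trans/conjugate_sym.
Qed.

End SEAPHomogenizable.

Lemma is_limit_witness (L : signature) (K : fin_class L) (T : countType)
    (M : structure L T) : is_limit K M -> forall A, exists B, limit_witness M A B.
Proof.
move=> [ageK ext] A; have [B [AB extB]] := ext A.
by exists B; split=> // U C e /ageK; apply: extB.
Qed.

Theorem theorem4p3 (L : signature) (K : fin_class L)
    (T : countType) (M : structure L T)
    (hK : weak_Fraisse_class K) (hM : is_limit K M) :
  homogenizable M <-> omega_categorical M /\ SEAP (age M).
Proof.
have limM := is_limit_witness hM; split=> [homM|[catM seap]].
  split; first exact: homogenizable_omega_categorical.
  by have [n [ar [phi hom]]] := homM; apply: homogenizable_SEAP hom.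
exact: SEAP_homogenizable.
Qed.
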